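(* Let $N\ge 1$, let $\mathbf{A}=[a_{ij}]$ and $\mathbf{B}=[b_{ij}]$ be the adjacency matrices of two undirected, connected graphs on the node set $\{1,\dots,N\}$, and let $\beta_1,\delta_1,\beta_2,\delta_2>0$ with $\tau_1=\beta_1/\delta_1$, $\tau_2=\beta_2/\delta_2$. Consider the bi-virus system $$\dot{\mathbf{x}}=\beta_1\,\mathrm{diag}(\mathbf{1}-\mathbf{x}-\mathbf{y})\mathbf{A}\mathbf{x}-\delta_1\mathbf{x},\qquad \dot{\mathbf{y}}=\beta_2\,\mathrm{diag}(\mathbf{1}-\mathbf{x}-\mathbf{y})\mathbf{B}\mathbf{y}-\delta_2\mathbf{y}$$ on $D=\{(\mathbf{x},\mathbf{y})\in[0,1]^{2N}:\mathbf{x}+\mathbf{y}\le\mathbf{1}\}$. If $\tau_1\lambda(\mathbf{A})\le 1$ and $\tau_2\lambda(\mathbf{B})\le 1$, then every trajectory of this system starting from any point of $D$ converges to $(\mathbf{0},\mathbf{0})$.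
   Context: $\lambda(\mathbf{M})$ denotes the largest real part of the eigenvalues of a square matrix $\mathbf{M}$ (for a nonnegative matrix this is its spectral radius). $\mathrm{diag}(\mathbf{v})$ is the diagonal matrix with the entries of $\mathbf{v}$ on the diagonal; $\mathbf{1}$ and $\mathbf{0}$ are the all-ones and all-zeros vectors in $\mathbb{R}^N$; vector inequalities are entrywise. *)

(* Defs.v *)
From HB Require Import structures.
From mathcomp Require Import all_boot all_order all_algebra.
From mathcomp Require Import all_classical all_reals all_analysis.
From mathcomp Require Import complex.
Set Implicit Arguments. Unset Strict Implicit. Unset Printing Implicit Defensive.
Import Order.TTheory GRing.Theory Num.Theory.
Import numFieldNormedType.Exports.
Local Open Scope classical_set_scope.
Local Open Scope ring_scope.

Definition undirected_adjacency (R : realType) (N : nat) (A : 'M[R]_N) : Prop :=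
  (forall i j, A i j = 0 \/ A i j = 1) /\
  (forall i j, A i j = A j i) /\
  (forall i, A i i = 0).

Definition graph_connected (R : realType) (N : nat) (A : 'M[R]_N) : Prop :=
  forall i j : 'I_N, connect (fun k l => A k l == 1) i j.

(* "tau * lambda(M) <= c", where lambda(M) is the largest real part of the
   (complex) eigenvalues of M, i.e. of the complex roots of the characteristic
   polynomial: unfolded as "tau * Re mu <= c for every eigenvalue mu". *)
Definition scaled_lambda_le (R : realType) (N : nat) (tau : R) (M : 'M[R]_N)
    (c : R) : Prop :=
  forall mu : R[i],
    root (map_poly (real_complex R) (char_poly M)) mu ->
    tau * complex.Re mu <= c.

Definition bivirus_fx (R : realType) (N : nat) (beta delta : R) (A : 'M[R]_N)
    (x y : 'I_N -> R) (i : 'I_N) : R :=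
  beta * (1 - x i - y i) * (\sum_(j < N) A i j * x j) - delta * x i.

Definition in_D (R : realType) (N : nat) (x y : 'I_N -> R) : Prop :=
  forall i, 0 <= x i /\ x i <= 1 /\ 0 <= y i /\ y i <= 1 /\ x i + y i <= 1.

Definition bivirus_solution (R : realType) (N : nat)
    (beta1 delta1 beta2 delta2 : R) (A B : 'M[R]_N)
    (x y : 'I_N -> R -> R) : Prop :=
  forall i,
    {within `[0, +oo[, continuous (x i)} /\
    {within `[0, +oo[, continuous (y i)} /\
    (forall t : R, 0 < t ->
       is_derive t 1 (x i)
         (bivirus_fx beta1 delta1 A (fun j => x j t) (fun j => y j t) i) /\
       is_derive t 1 (y i)
         (bivirus_fx beta2 delta2 B (fun j => y j t) (fun j => x j t) i)).

(* Main.v *)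
Require Import Defs.
From HB Require Import structures.
From mathcomp Require Import all_boot all_order all_algebra.
From mathcomp Require Import all_classical all_reals all_analysis.
From mathcomp Require Import complex spectral ring lra.
Import Order.TTheory GRing.Theory Num.Theory.
Import numFieldNormedType.Exports.
Local Open Scope classical_set_scope.
Local Open Scope ring_scope.

(** D is forward invariant because each of x_i, y_i and 1 - x_i - y_i can
    decrease below 0 only at a rate bounded by the negative parts of all of them.
    On D, let V = sum_i x_i^2 and Q = delta I - beta A.  The eigenvalue bound
    and the symmetry of A make Q positive semidefinite, and
    V' <= -2 (<x, Q x> + beta sum_i x_i^2 (A x)_i).
    Both terms on the right are nonnegative.  Since beta A x = delta x - Q x and
    |Q x|^2 = O(<x, Q x>), completing the square bounds their sum below by
    kappa sum_i x_i^3 with kappa > 0, which covers the critical case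
    tau lambda(A) = 1 and forces V to 0.  The same applies to y. *)

Set Implicit Arguments.
Unset Strict Implicit.

Lemma nonincreasing_of_derive (R : realType) (f df : R -> R) (a b : R) :
  {within `[a, b], continuous f} ->
  (forall t, a < t < b -> is_derive t 1 f (df t)) ->
  (forall t, a < t < b -> df t <= 0) ->
  forall s t, a <= s -> s <= t -> t <= b -> f t <= f s.
Proof.
move=> cf fdf df0 s t as_ st tb.
have itvE u : u \in `]a, b[ -> a < u < b by rewrite in_itv.
have Hd u : u \in `]a, b[ -> derivable f u 1.
  by move=> /itvE /fdf H; exact: ex_derive.
have Hn u : u \in `]a, b[ -> derive1 f u <= 0.
  move=> /itvE uab; rewrite derive1E; have H := fdf _ uab.
  by rewrite derive_val; exact: df0.
apply: (ler0_derive1_le_cc Hd Hn cf) => //; rewrite in_itv /=.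
- by rewrite (le_trans as_ st) tb.
- by rewrite as_ (le_trans st tb).
Qed.

Lemma is_derive_quadratic_bound (R : realType) (f : R -> R) (a d : R) :
  (forall h, `|f (a + h) - f a - d * h| <= h ^+ 2) -> is_derive a 1 f d.
Proof.
move=> H.
suff L : h^-1 *: ((f \o shift a) (h *: 1) - f a) @[h --> 0^'] --> d.
  by apply: DeriveDef; [apply/cvg_ex; exists d | exact: cvg_lim].
apply/cvgrPdist_le => e e0; near=> h.
have h0 : h != 0 by near: h; exact: nbhs_dnbhs_neq.
have he : `|h| <= e.
  by near: h; exact: dnbhs0_le.
have -> : d - h^-1 *: ((f \o shift a) (h *: 1) - f a) =
   - (h^-1 * (f (a + h) - f a - d * h)).
  rewrite /= /shift /= [h *: 1]mulr1 [h + a]addrC /GRing.scale /=; field.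
  exact: h0.
rewrite normrN normrM normfV ler_pdivrMl ?normr_gt0 //.
apply: (le_trans (H h)); rewrite -[h ^+ 2]ger0_norm ?sqr_ge0 // normrX expr2.
by rewrite ler_wpM2l.
Unshelve. all: by end_near.
Qed.

Lemma is_derive_sqr_minr0 (R : realType) (u : R) :
  is_derive u 1 (fun v : R => Num.min v 0 ^+ 2) (2 * Num.min u 0).
Proof.
apply: is_derive_quadratic_bound => h; rewrite ler_norml !expr2.
case: (leP u 0) => hu; case: (leP (u + h) 0) => huh; apply/andP; split; nra.
Qed.

Lemma is_derive_bigsum (R : realType) (I : finType) (f : I -> R -> R)
    (df : I -> R) (t : R) :
  (forall i, is_derive t 1 (f i) (df i)) ->
  is_derive t 1 (fun s => \sum_i f i s) (\sum_i df i).
Proof.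
move=> H; rewrite -[fun s => _]fct_sumE.
elim/big_ind2 : _ => //; first exact: is_derive_cst.
by move=> g dg k dk Hg Hk; exact: is_deriveD.
Qed.

Lemma within_continuous_bigsum (R : realType) (I : finType) (D : set R)
    (f : I -> R -> R) :
  (forall i, {within D, continuous (f i)}) ->
  {within D, continuous (fun s => \sum_i f i s)}.
Proof.
move=> H; rewrite -[fun s => _]fct_sumE.
elim/big_ind : _ => //; first by move=> t; exact: cvg_cst.
by move=> g k Hg Hk t; apply: cvgD; [exact: Hg | exact: Hk].
Qed.

Lemma within_continuous_bounded (R : realType) (f : R -> R) (a b : R) :
  {within `[a, b], continuous f} ->
  exists2 M, 0 <= M & forall t, a <= t <= b -> `|f t| <= M.
Proof.
move=> cf; case: (leP a b) => [ab|ba]; last first.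
  exists 0 => // t /andP[at_ tb].
  by have := lt_le_trans ba (le_trans at_ tb); rewrite ltxx.
have cn : {within `[a, b], continuous (fun t => `|f t|)}.
  by move=> t; apply: cvg_norm; exact: cf.
have [c _ Hc] := EVT_max ab cn.
by exists `|f c| => // t tab; apply: Hc; rewrite in_itv.
Qed.

Lemma sum_mul_sum_le (R : realType) (I : finType) (m : I -> R) :
  2 * \sum_k m k * (\sum_l m l) <= 2 * #|I|%:R * \sum_k m k ^+ 2.
Proof.
have -> : 2 * #|I|%:R * \sum_k m k ^+ 2 =
    \sum_k \sum_l (m k ^+ 2 + m l ^+ 2).
  under [RHS]eq_bigr do rewrite big_split /= sumr_const.
  rewrite big_split /= sumr_const sumrMnl.
  by rewrite -[X in _ = X + _]mulr_natl -[X in _ = _ + X]mulr_natl; ring.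
rewrite mulr_sumr; apply: ler_sum => k _; rewrite mulrA mulr_sumr.
apply: ler_sum => l _; have := sqr_ge0 (m k - m l); rewrite sqrrB; nra.
Qed.

(* Gronwall applied to the sum of the squared negative parts. *)
Lemma quasipositive_nonneg (R : realType) (I : finType) (w dw : I -> R -> R)
    (T C : R) :
  0 <= C ->
  (forall k, {within `[0, T], continuous (w k)}) ->
  (forall k (t : R), 0 < t < T -> is_derive t 1 (w k) (dw k t)) ->
  (forall k, 0 <= w k 0) ->
  (forall k (t : R), 0 < t < T -> w k t <= 0 ->
     C * \sum_l Num.min (w l t) 0 <= dw k t) ->
  forall k t, 0 <= t <= T -> 0 <= w k t.
Proof.
move=> C0 cw dwP w0 wle k t /andP[t0 tT].
pose E (s : R) : R := \sum_k Num.min (w k s) 0 ^+ 2.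
pose dE (s : R) : R := \sum_k 2 * Num.min (w k s) 0 * dw k s.
pose K : R := C * (2 * #|I|%:R).
pose g (s : R) : R := E s * expR (- K * s).
have dEP (s : R) : 0 < s < T -> is_derive s 1 E (dE s).
  move=> sT; apply: is_derive_bigsum => l.
  have H1 := dwP l s sT; have H2 := is_derive_sqr_minr0 (w l s).
  exact: (is_derive1_comp H2 H1).
have dexpP (s : R) :
    is_derive s 1 (fun u : R => expR (- K * u)) (expR (- K * s) * - K).
  have H1 : is_derive s 1 (fun u : R => - K * u) (- K).
    have := @is_deriveZ _ _ _ (@id R) (- K) s 1 1 (is_derive_id _ _).
    by rewrite /GRing.scale /= mulr1.
  exact: (is_derive1_comp (is_derive_expR _) H1).
have dgP (s : R) : 0 < s < T ->
    is_derive s 1 g (E s * (expR (- K * s) * - K) + expR (- K * s) * dE s).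
  move=> sT; have := dEP s sT => H1; have H2 := dexpP s.
  exact: (is_deriveM H1 H2).
have cg : {within `[0, T], continuous g}.
  have cE : {within `[0, T], continuous E}.
    apply: within_continuous_bigsum => l s.
    apply: (@continuous_comp _ _ _ (w l : subspace `[0, T] -> R)
      (fun v : R => Num.min v 0 ^+ 2)); first exact: cw.
    apply: differentiable_continuous; apply/derivable1_diffP.
    have H := is_derive_sqr_minr0 (w l s); exact: ex_derive.
  have ce : {within `[0, T], continuous (fun u : R => expR (- K * u))}.
    apply: continuous_subspaceT => s.
    apply: differentiable_continuous; apply/derivable1_diffP.
    have H := dexpP s; exact: ex_derive.
  by move=> s; apply: cvgM; [exact: cE | exact: ce].
have dElow s : 0 < s < T -> dE s <= K * E s.
  move=> sT.
  have : dE s <=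
      C * (2 * \sum_k Num.min (w k s) 0 * (\sum_l Num.min (w l s) 0)).
    set S := \sum_l Num.min (w l s) 0.
    rewrite !mulr_sumr; apply: ler_sum => l _.
    rewrite -mulrA [leRHS]mulrCA ler_pM2l ?ltr0n // [leRHS]mulrCA.
    case: (leP (w l s) 0) => wl0; last by rewrite !mul0r.
    by rewrite ler_wnM2l // wle.
  move/le_trans; apply; rewrite /K -mulrA ler_wpM2l // sum_mul_sum_le //.
have Et0 : E t <= 0.
  have gt0 : g t <= g 0.
    apply: (nonincreasing_of_derive cg dgP) => // s sT.
    have := dElow s sT; have := expR_gt0 (- K * s); nra.
  have E0 : E 0 = 0.
    rewrite /E big1 // => l _; rewrite (_ : Num.min _ _ = 0) ?expr0n //.
    by apply/min_idPr; exact: w0.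
  move: gt0; rewrite /g E0 mul0r; have := expR_gt0 (- K * t); nra.
have Ek : Num.min (w k t) 0 ^+ 2 <= E t.
  rewrite /E (bigD1 k) //= lerDl; apply: sumr_ge0 => l _; exact: sqr_ge0.
have := le_trans Ek Et0; case: (leP (w k t) 0) => [wk|/ltW //].
by have := sqr_ge0 (w k t); rewrite expr2; nra.
Qed.

Lemma mul_rowsum_ge (R : realType) (N : nat) (a X : 'I_N -> R) (z L S : R) :
  (forall j, 0 <= a j <= 1) -> (forall j, `|X j| <= L) -> `|z| <= L ->
  S <= 0 -> S <= z -> (forall j, S <= X j) ->
  N%:R * (2 * L) * S <= z * \sum_j a j * X j.
Proof.
move=> a01 XL zL S0 Sz SX.
have -> : N%:R * (2 * L) * S = \sum_(j < N) 2 * L * S.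
  by rewrite sumr_const card_ord -mulrA mulr_natl.
rewrite mulr_sumr; apply: ler_sum => j _.
have /andP[a0 a1] := a01 j; have := SX j.
move: (XL j) zL; rewrite !ler_norml => /andP[x1 x2] /andP[z1 z2] Sj.
have L0 : 0 <= L by lra.
rewrite mulrCA; suff H : 2 * L * S <= z * X j.
  have : 2 * L * S <= 0 by nra.
  by move: (2 * L * S) (z * X j) H => p q; case: (leP 0 q); nra.
case: (leP 0 z) => z0; case: (leP 0 (X j)) => X0; nra.
Qed.

Lemma norm_rowsum_le (R : realType) (N : nat) (a X : 'I_N -> R) (L : R) :
  (forall j, 0 <= a j <= 1) -> (forall j, `|X j| <= L) ->
  `|\sum_j a j * X j| <= N%:R * L.
Proof.
move=> a01 XL; apply: (le_trans (ler_norm_sum _ _ _)).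
rewrite mulr_natl -[X in _ *+ X]card_ord -sumr_const; apply: ler_sum => j _.
have /andP[a0 a1] := a01 j; rewrite normrM ger0_norm //.
by have := XL j; have := normr_ge0 (X j); nra.
Qed.

Lemma bivirus_in_D (R : realType) (N : nat) (A B : 'M[R]_N)
    (beta1 delta1 beta2 delta2 : R) (x y : 'I_N -> R -> R) :
  (forall i j, 0 <= A i j <= 1) -> (forall i j, 0 <= B i j <= 1) ->
  0 <= beta1 -> 0 <= delta1 -> 0 <= beta2 -> 0 <= delta2 ->
  bivirus_solution beta1 delta1 beta2 delta2 A B x y ->
  in_D (fun i => x i 0) (fun i => y i 0) ->
  forall t, 0 <= t -> in_D (fun i => x i t) (fun i => y i t).
Proof.
move=> A01 B01 b1 d1 b2 d2 sol D0 T T0.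
have sub : `[0, T] `<=` `[0, +oo[.
  by move=> s /=; rewrite !in_itv /= => /andP[-> _].
have cx i : {within `[0, T], continuous (x i)}.
  by have [H _] := sol i; exact: continuous_subspaceW sub H.
have cy i : {within `[0, T], continuous (y i)}.
  by have [_ [H _]] := sol i; exact: continuous_subspaceW sub H.
have [M M0 HM] : exists2 M, 0 <= M & forall s, 0 <= s <= T ->
    forall i, `|x i s| <= M /\ `|y i s| <= M.
  have c : {within `[0, T], continuous (fun s => \sum_i (`|x i s| + `|y i s|))}.
    apply: within_continuous_bigsum => i s; apply: cvgD; apply: cvg_norm.
      exact: cx.
    exact: cy.
  have [M M0 HM] := within_continuous_bounded c.
  exists M => // s /HM; rewrite ger0_norm; last first.
    by apply: sumr_ge0 => i _; rewrite addr_ge0.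
  move=> H i; have : `|x i s| + `|y i s| <= M.
    apply: le_trans H; rewrite (bigD1 i) //= lerDl.
    by apply: sumr_ge0 => j _; rewrite addr_ge0.
  by have := normr_ge0 (x i s); have := normr_ge0 (y i s); split; lra.
pose w (k : 'I_N + 'I_N + 'I_N) (s : R) : R := match k with
  | inl (inl i) => x i s
  | inl (inr i) => y i s
  | inr i => 1 - x i s - y i s
  end.
pose fx i s := bivirus_fx beta1 delta1 A (fun j => x j s) (fun j => y j s) i.
pose fy i s := bivirus_fx beta2 delta2 B (fun j => y j s) (fun j => x j s) i.
pose dw (k : 'I_N + 'I_N + 'I_N) (s : R) : R := match k with
  | inl (inl i) => fx i s
  | inl (inr i) => fy i s
  | inr i => - fx i s - fy i s
  end.
pose L : R := 1 + 2 * M.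
pose C : R := (beta1 + beta2) * (N%:R * (2 * L)) + delta1 + delta2.
have L0 : 0 <= L by rewrite /L; lra.
have NL0 : 0 <= N%:R * (2 * L) by rewrite !mulr_ge0.
have C0 : 0 <= C by rewrite /C; nra.
suff H k : 0 <= w k T.
  move=> i; have := H (inl (inl i)); have := H (inl (inr i)).
  by have := H (inr i); rewrite /w => *; repeat split; lra.
apply: (@quasipositive_nonneg _ _ w dw T C) => //; last by rewrite T0 lexx.
- case=> [[]|] i //=; first exact: cx.
    exact: cy.
  move=> s; apply: cvgB; last exact: cy.
  by apply: cvgB; [exact: cvg_cst | exact: cx].
- move=> {}k s /andP[s0 _].
  have Hx i : is_derive s 1 (x i) (fx i s) by have [_ [_ /(_ s s0)[]]] := sol i.
  have Hy i : is_derive s 1 (y i) (fy i s) by have [_ [_ /(_ s s0)[]]] := sol i.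
  case: k => [[]|] i; [exact: Hx | exact: Hy |].
  rewrite /= -[- fx i s]sub0r; apply: is_deriveB; apply: is_deriveB.
- by case=> [[]|] i /=; have := D0 i => /=; lra.
- move=> {}k s /andP[s0 sT].
  set S := \sum_l _ => wk.
  have S0 : S <= 0.
    by apply: sumr_le0 => l _; rewrite ge_min lexx orbT.
  have Sw l : S <= w l s.
    apply: (@le_trans _ _ (Num.min (w l s) 0)); last by rewrite ge_min lexx.
    rewrite /S (bigD1 l) //= gerDl; apply: sumr_le0 => l' _.
    by rewrite ge_min lexx orbT.
  have Mi i : `|x i s| <= M /\ `|y i s| <= M by apply: HM; rewrite !ltW.
  have zL i : `|1 - x i s - y i s| <= L.
    have [] := Mi i; rewrite /L !ler_norml => /andP[? ?] /andP[? ?].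
    by apply/andP; split; lra.
  have xL i : `|x i s| <= L by have [] := Mi i; rewrite /L; lra.
  have yL i : `|y i s| <= L by have [] := Mi i; rewrite /L; lra.
  have Sx i : S <= x i s := Sw (inl (inl i)).
  have Sy i : S <= y i s := Sw (inl (inr i)).
  have Sz i : S <= 1 - x i s - y i s := Sw (inr i).
  have NLS : N%:R * (2 * L) * S <= 0 by nra.
  case: k wk => [[]|] i /= wk.
  + rewrite /fx /bivirus_fx.
    have := mul_rowsum_ge (A01 i) xL (zL i) S0 (Sz i) Sx.
    set V := (1 - _ - _) * _; rewrite /C => HV; rewrite -mulrA -/V.
    nra.
  + rewrite /fy /bivirus_fx.
    have zE : 1 - y i s - x i s = 1 - x i s - y i s by ring.
    have := mul_rowsum_ge (B01 i) yL (zL i) S0 (Sz i) Sy.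
    rewrite zE; set V := (1 - _ - _) * _; rewrite /C => HV; rewrite -mulrA -/V.
    nra.
  + rewrite /fx /fy /bivirus_fx.
    have zE : 1 - y i s - x i s = 1 - x i s - y i s by ring.
    rewrite zE.
    have := norm_rowsum_le (A01 i) xL; have := norm_rowsum_le (B01 i) yL.
    move: (Sz i) (Sx i) (Sy i) wk.
    set z := 1 - _ - _; set U := \sum_j A i j * _; set V := \sum_j B i j * _.
    rewrite !ler_norml => Szi Sxi Syi wk /andP[V1 V2] /andP[U1 U2].
    have H1 : N%:R * (2 * L) * S <= - z * U.
      have : N%:R * L * z <= - z * U by nra.
      nra.
    have H2 : N%:R * (2 * L) * S <= - z * V.
      have : N%:R * L * z <= - z * V by nra.
      nra.
    rewrite /C; nra.
Qed.

Lemma scaled_lambda_le_quadratic (R : realType) (N : nat) (A : 'M[R]_N)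
    (beta delta : R) :
  (forall i j, A i j = A j i) -> 0 < delta ->
  scaled_lambda_le (beta / delta) A 1 ->
  forall z : 'I_N -> R,
    beta * \sum_i z i * (\sum_j A i j * z j) <= delta * \sum_i z i ^+ 2.
Proof.
move=> symA d0 lamA z.
pose rc := real_complex R.
pose Ac : 'M[R[i]]_N := map_mx rc A.
have rcR a : rc a \is Num.real by apply/complex_realP; exists a.
have hA : Ac \is hermsymmx.
  apply: realsym_hermsym.
    apply/is_hermitianmxP; rewrite expr0 scale1r map_mx_id //.
    by apply/matrixP => i j; rewrite !mxE symA.
  by apply/mxOverP => i j; rewrite mxE.
have := hermitian_normalmx hA => /orthomx_spectralP.
have /mxOverP spR := hermitian_spectral_diag_real hA.
have Pu : spectralmx Ac \is unitarymx := spectral_unitarymx Ac.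
have Pn : spectralmx Ac \in unitmx := spectral_unit Ac.
move: Pu Pn spR; move: (spectralmx Ac) (spectral_diag Ac) => P sp Pu Pn spR AcE.
have rt i : root (map_poly (real_complex R) (char_poly A)) (sp 0 i).
  rewrite map_char_poly -/rc -/Ac -eigenvalue_root_char; apply/eigenvalueP.
  exists (row i P).
    rewrite -row_mul AcE !mulmxA mulmxV // mul1mx row_mul row_diag_mx.
    by rewrite -scalemxAl -rowE.
  apply: contraTneq Pn => Pi0; rewrite unitmxE unitfE negbK.
  rewrite (expand_det_row _ i) big1 // => j _.
  by move/rowP/(_ j): Pi0; rewrite !mxE => ->; rewrite mul0r.
pose v : 'cV[R[i]]_N := \col_i rc (z i).
have vH : (v ^t* = v^T)%sesqui.
  by apply/matrixP => i j; rewrite !mxE conj_Creal.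
have [u uE] : {u | u = P *m v} by exists (P *m v).
have uH : (u ^t* = v^T *m invmx P)%sesqui.
  by rewrite invmx_unitary // uE trmx_mul map_mxM vH.
pose c i := complex.Re (`|u i 0| ^+ 2).
have cE i : rc (c i) = `|u i 0| ^+ 2.
  by rewrite /rc /c RRe_real // realX // normr_real.
have c0 i : 0 <= c i.
  by rewrite -(lecR _ (c i)) -/(rc (c i)) cE exprn_ge0.
have spE i : rc (complex.Re (sp 0 i)) = sp 0 i by rewrite /rc RRe_real.
have uu : \sum_i z i ^+ 2 = \sum_i c i.
  apply: (fmorph_inj (real_complex R)); rewrite !rmorph_sum /=.
  have : ((u ^t*)%sesqui *m u) 0 0 = (v^T *m v) 0 0.
    by rewrite uH uE mulmxA mulmxKV.
  rewrite mxE [RHS]mxE => E.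
  transitivity (\sum_j v^T 0 j * v j 0).
    by apply: eq_bigr => i _; rewrite !mxE rmorphXn expr2.
  rewrite -E; apply: eq_bigr => i _; rewrite !mxE.
  by rewrite -/rc cE normCK mulrC.
have uAu : \sum_i z i * (\sum_j A i j * z j) = \sum_i complex.Re (sp 0 i) * c i.
  apply: (fmorph_inj (real_complex R)); rewrite !rmorph_sum /=.
  have : ((u ^t*)%sesqui *m (diag_mx sp *m u)) 0 0 = (v^T *m (Ac *m v)) 0 0.
    by rewrite uH uE AcE !mulmxA.
  rewrite mxE [RHS]mxE => E.
  transitivity (\sum_j v^T 0 j * (Ac *m v) j 0).
    apply: eq_bigr => i _; rewrite !mxE rmorphM rmorph_sum /=; congr (_ * _).
    by apply: eq_bigr => j _; rewrite !mxE rmorphM.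
  rewrite -E; apply: eq_bigr => i _; rewrite mul_diag_mx !mxE.
  by rewrite rmorphM /= -/rc cE spE normCK; ring.
rewrite uu uAu !mulr_sumr; apply: ler_sum => i _; rewrite mulrA.
apply: ler_wpM2r => //; have := lamA _ (rt i).
by rewrite mulrAC ler_pdivrMr // mul1r.
Qed.

Definition bform (R : realType) (N : nat) (A : 'M[R]_N) (u v : 'I_N -> R) : R :=
  \sum_i u i * (\sum_j A i j * v j).

Lemma bformC (R : realType) (N : nat) (A : 'M[R]_N) (u v : 'I_N -> R) :
  (forall i j, A i j = A j i) -> bform A u v = bform A v u.
Proof.
move=> symA; rewrite /bform; under eq_bigr do rewrite mulr_sumr.
rewrite exchange_big; apply: eq_bigr => i _; rewrite mulr_sumr.
by apply: eq_bigr => j _; rewrite symA; ring.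
Qed.

Lemma bformBZl (R : realType) (N : nat) (A : 'M[R]_N) (u v w : 'I_N -> R)
    (s : R) :
  bform A (fun i => u i - s * v i) w = bform A u w - s * bform A v w.
Proof.
by rewrite /bform mulr_sumr -sumrB; apply: eq_bigr => i _; ring.
Qed.

Lemma bform_ge (R : realType) (N : nat) (A : 'M[R]_N) (u : 'I_N -> R) :
  (forall i j, 0 <= A i j <= 1) ->
  - (N%:R * \sum_i u i ^+ 2) <= bform A u u.
Proof.
move=> A01; rewrite lerNl.
have := sum_mul_sum_le (fun i => `|u i|).
rewrite card_ord -mulrA ler_pM2l ?ltr0n //.
under [X in _ <= _ * X]eq_bigr do rewrite real_normK ?num_real //.
apply: le_trans; rewrite -sumrN; apply: ler_sum => i _.
rewrite -mulrN -sumrN (le_trans (ler_norm _)) // normrM ler_wpM2l //.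
apply: (le_trans (ler_norm_sum _ _ _)); apply: ler_sum => j _.
have /andP[a0 a1] := A01 i j; rewrite normrN normrM ger0_norm //.
by have := normr_ge0 (u j); nra.
Qed.

(* For positive semidefinite Q = delta - beta A with Q <= K, positivity at
   x - Qx / K gives |Qx|^2 <= K <x, Qx>. *)
Lemma sqr_gradient_le (R : realType) (N : nat) (A : 'M[R]_N) (beta delta : R)
    (x : 'I_N -> R) :
  (forall i j, 0 <= A i j <= 1) -> (forall i j, A i j = A j i) ->
  0 <= beta -> 0 < delta ->
  (forall z, beta * bform A z z <= delta * \sum_i z i ^+ 2) ->
  (delta + beta * N%:R)^-1 *
    \sum_i (delta * x i - beta * \sum_j A i j * x j) ^+ 2 <=
  delta * \sum_i x i ^+ 2 - beta * bform A x x.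
Proof.
move=> A01 symA b0 d0 psd.
set K := delta + _; set g := fun i => delta * x i - beta * \sum_j A i j * x j.
have K0 : 0 < K by rewrite /K ltr_wpDr // mulr_ge0.
pose s := K^-1.
have sK : s * K = 1 by rewrite mulVf // gt_eqF.
have s0 : 0 < s by rewrite invr_gt0.
have gg : \sum_i g i ^+ 2 = delta * \sum_i x i * g i - beta * bform A g x.
  rewrite /bform !mulr_sumr -sumrB; apply: eq_bigr => i _.
  by rewrite expr2 {1}/g; ring.
have sq : \sum_i (x i - s * g i) ^+ 2 =
    \sum_i x i ^+ 2 - 2 * s * (\sum_i x i * g i) + s ^+ 2 * \sum_i g i ^+ 2.
  rewrite !mulr_sumr -sumrB -big_split /=; apply: eq_bigr => i _; ring.
have := psd (fun i => x i - s * g i); rewrite sq.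
rewrite bformBZl (bformC x) // (bformC g) // !(bformBZl A x g) (bformC x g) //.
have := bform_ge g A01.
rewrite -/s; move: gg.
set G := \sum_i g i ^+ 2; set X := \sum_i x i ^+ 2; set XG := \sum_i x i * g i.
set bgg := bform A g g; set bgx := bform A g x; set bxx := bform A x x.
move=> gg Hg Hz.
have Hg' : delta * G - beta * bgg <= K * G by rewrite /K; nra.
have H2 : s ^+ 2 * (delta * G - beta * bgg) <= s * G.
  have -> : s * G = s ^+ 2 * (K * G).
    by rewrite expr2 -!mulrA (mulrA s K) sK mul1r.
  by rewrite ler_wpM2l // sqr_ge0.
have E : s * G = s * (delta * XG - beta * bgx) by rewrite -gg.
lra.
Qed.

Lemma cubic_dissipation (R : realType) (N : nat) (A : 'M[R]_N)
    (beta delta : R) :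
  (forall i j, 0 <= A i j <= 1) -> (forall i j, A i j = A j i) ->
  0 <= beta -> 0 < delta ->
  (forall z, beta * bform A z z <= delta * \sum_i z i ^+ 2) ->
  exists2 kappa, 0 < kappa & forall x : 'I_N -> R, (forall i, 0 <= x i <= 1) ->
    kappa * \sum_i x i ^+ 3 <=
    delta * \sum_i x i ^+ 2 - beta * bform A x x +
    beta * bform A (fun i => x i ^+ 2) x.
Proof.
move=> A01 symA b0 d0 psd.
pose a := (delta + beta * N%:R)^-1.
have a0 : 0 < a by rewrite invr_gt0 ltr_wpDr // mulr_ge0.
pose th := Num.min 1 (2 * a * delta).
have th0 : 0 < th by rewrite lt_min ltr01 /= !mulr_gt0.
have th1 : th <= 1 by rewrite ge_min lexx.
have th2 : th <= 2 * a * delta by rewrite ge_min lexx orbT.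
exists (th * delta / 2) => [|x x01]; first by rewrite divr_gt0 // mulr_gt0.
have := sqr_gradient_le x A01 symA b0 d0 psd; rewrite -/a.
have c0 : 0 <= beta * bform A (fun i => x i ^+ 2) x.
  rewrite mulr_ge0 // sumr_ge0 // => i _; rewrite mulr_ge0 ?sqr_ge0 //.
  apply: sumr_ge0 => j _; have /andP[? _] := A01 i j; have /andP[? _] := x01 j.
  exact: mulr_ge0.
move: c0; set c := beta * _; set q := _ - _ => c0 Hq.
suff : th * delta / 2 * \sum_i x i ^+ 3 <=
    a * \sum_i (delta * x i - beta * \sum_j A i j * x j) ^+ 2 + th * c by nra.
rewrite /c /bform !mulr_sumr -big_split /=; apply: ler_sum => i _.
have /andP[x0 x1] := x01 i; set U := \sum_j _.
set g := delta * x i - _.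
have -> : th * (beta * (x i ^+ 2 * U)) = th * (x i ^+ 2 * (delta * x i - g)).
  by rewrite /g; ring.
move: (x i) x0 x1 g => {U} y y0 y1 g.
have y3 : 0 <= y ^+ 3 by rewrite exprn_ge0.
have y4 : y ^+ 4 <= y ^+ 3 by rewrite exprS ler_piMl.
(* completing the square in g *)
have sq : 0 <= (2 * a * g - th * y ^+ 2) ^+ 2 := sqr_ge0 _.
rewrite -subr_ge0 -(pmulr_rge0 _ (mulr_gt0 (ltr0n R 4) a0)).
have t4 : th ^+ 2 * y ^+ 4 <= th * (2 * a * delta) * y ^+ 3.
  apply: ler_pM => //; rewrite ?sqr_ge0 ?exprn_ge0 //.
  by rewrite expr2 ler_pM2l.
rewrite (_ : 4 * a * _ = (2 * a * g - th * y ^+ 2) ^+ 2 +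
   (th * (2 * a * delta) * y ^+ 3 - th ^+ 2 * y ^+ 4)); last by field.
by rewrite addr_ge0 // subr_ge0.
Qed.

Lemma adjacency_itv (R : realType) (N : nat) (A : 'M[R]_N) :
  undirected_adjacency A -> forall i j, 0 <= A i j <= 1.
Proof. by case=> H _ i j; case: (H i j) => ->; rewrite ?lexx ?ler01. Qed.

Lemma dominated_virus_cvg0 (R : realType) (N : nat) (A : 'M[R]_N)
    (beta delta : R) (x y : 'I_N -> R -> R) :
  undirected_adjacency A -> 0 < beta -> 0 < delta ->
  scaled_lambda_le (beta / delta) A 1 ->
  (forall i, {within `[0, +oo[, continuous (x i)}) ->
  (forall i (t : R), 0 < t -> is_derive t 1 (x i)
     (bivirus_fx beta delta A (fun j => x j t) (fun j => y j t) i)) ->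
  (forall t, 0 <= t -> in_D (fun i => x i t) (fun i => y i t)) ->
  forall i, x i t @[t --> +oo] --> 0.
Proof.
move=> adjA b0 d0 lamA cx dx xD.
have A01 := adjacency_itv adjA; have [_ [symA _]] := adjA.
have [kappa k0 diss] := cubic_dissipation A01 symA (ltW b0) d0
  (scaled_lambda_le_quadratic symA d0 lamA).
pose V (t : R) : R := \sum_i x i t * x i t.
pose f i (t : R) := bivirus_fx beta delta A (fun j => x j t) (fun j => y j t) i.
pose dV (t : R) : R := \sum_i (x i t * f i t + x i t * f i t).
have V0 t : 0 <= V t by apply: sumr_ge0 => i _; rewrite -expr2 sqr_ge0.
have dVP (t : R) : 0 < t -> is_derive t 1 V (dV t).
  move=> t0; apply: is_derive_bigsum => i.
  have H := dx i t t0; exact: (is_deriveM H H).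
have cV (T : R) : {within `[0, T], continuous V}.
  have sub : `[0, T] `<=` `[0, +oo[.
    by move=> s /=; rewrite !in_itv /= => /andP[-> _].
  apply: (continuous_subspaceW sub); apply: within_continuous_bigsum => i s.
  by apply: cvgM; exact: cx.
have dVle t : 0 < t -> dV t <= - (2 * kappa * \sum_i x i t ^+ 3).
  move=> t0; have xt := xD t (ltW t0).
  have x01 i : 0 <= x i t <= 1 by have [-> [-> _]] := xt i.
  rewrite -mulrA lerNr.
  apply: le_trans (_ : 2 * _ <= _); first exact: ler_wpM2l (diss _ x01).
  rewrite /bform /dV !mulr_sumr -sumrB -big_split /= mulr_sumr -sumrN.
  apply: ler_sum => i _; rewrite /f /bivirus_fx.
  have U0 : 0 <= \sum_j A i j * x j t.
    apply: sumr_ge0 => j _; have /andP[? _] := A01 i j.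
    by have /andP[? _] := x01 j; exact: mulr_ge0.
  have [xi0 [_ [yi0 _]]] := xt i.
  have : 0 <= beta * (x i t * (y i t * \sum_j A i j * x j t)).
    by rewrite !mulr_ge0 // ltW.
  move: (\sum_j _) => U; lra.
have dV0 t : 0 < t -> dV t <= 0.
  move=> t0; apply: (le_trans (dVle t t0)); rewrite oppr_le0 mulr_ge0 //.
    by rewrite mulr_ge0 // ltW.
  by apply: sumr_ge0 => i _; have [? _] := xD t (ltW t0) i; rewrite exprn_ge0.
have Vdecr s t : 0 <= s -> s <= t -> V t <= V s.
  move=> s0 st; apply: (nonincreasing_of_derive (df := dV) (cV t)) => //.
    by move=> u /andP[u0 _]; exact: dVP.
  by move=> u /andP[u0 _]; exact: dV0.
have Vsmall e : 0 < e -> exists2 t, 0 <= t & V t < e.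
  move=> e0; apply: contrapT => Hn.
  have Ve t : 0 <= t -> e <= V t.
    by move=> t0; rewrite leNgt; apply/negP => Vt; apply: Hn; exists t.
  pose eta : R := Num.min 1 (e / (2 * N.+1%:R)).
  have eta0 : 0 < eta by rewrite lt_min ltr01 divr_gt0 // mulr_gt0.
  have eta1 : eta <= 1 by rewrite ge_min lexx.
  have Neta : N%:R * eta ^+ 2 <= e / 2.
    have : eta <= e / (2 * N.+1%:R) by rewrite ge_min lexx orbT.
    rewrite ler_pdivlMr ?mulr_gt0 // -(natr1 N) => H.
    have N0 : 0 <= N%:R :> R by rewrite ler0n.
    have : N%:R * eta ^+ 2 <= N%:R * eta.
      by rewrite ler_wpM2l // expr2 ler_piMr // ltW.
    lra.
  pose c := kappa * eta * e.
  have c0 : 0 < c by rewrite !mulr_gt0.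
  have dVc t : 0 < t -> dV t <= - c.
    move=> t0; apply: (le_trans (dVle t t0)); rewrite lerN2.
    have : eta * V t <= N%:R * eta ^+ 3 + \sum_i x i t ^+ 3.
      rewrite -[N in N%:R]card_ord mulr_natl -sumr_const -big_split /=.
      rewrite mulr_sumr; apply: ler_sum => i _.
      have [xi0 _] := xD t (ltW t0) i; rewrite !exprS expr0 !mulr1.
      move: (x i t) xi0 => /= z z0.
      case: (leP z eta) => ze.
        have : z * z <= eta * eta by nra.
        have : 0 <= z * (z * z) by rewrite !mulr_ge0.
        nra.
      have : 0 <= z * z by rewrite mulr_ge0.
      have : 0 <= eta * (eta * eta) by rewrite !mulr_ge0 // ltW.
      nra.
    have := Ve t (ltW t0); rewrite /c exprS; move: (\sum_i _) => S Vt HS.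
    have : eta * e / 2 <= S by nra.
    nra.
  pose T := V 0 / c + 1.
  have T0 : 0 <= T by rewrite addr_ge0 // divr_ge0 // ltW.
  have : V T + c * T <= V 0 + c * 0.
    apply: (nonincreasing_of_derive (f := fun s => V s + c * s)
      (df := fun s => dV s + c) (a := 0) (b := T)) => //.
    - have cc : {within `[0, T], continuous (fun s : R => c * s)}.
        by apply: continuous_subspaceT => s; exact: mulrl_continuous.
      by move=> s; apply: cvgD; [exact: cV | exact: cc].
    - move=> s /andP[s0 _]; have H := dVP s s0; apply: is_deriveD.
      have := @is_deriveZ _ _ _ (@id R) c s 1 1 (is_derive_id _ _).
      by rewrite /GRing.scale /= mulr1.
    - by move=> s /andP[s0 _]; have := dVc s s0; lra.
  rewrite mulr0 addr0 /T mulrDr mulr1 mulrCA divff ?gt_eqF // mulr1.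
  by have := V0 (V 0 / c + 1); lra.
move=> i; apply/cvgrPdist_le => e e0.
have [t0 t00 Vt0] := Vsmall (e ^+ 2) (exprn_gt0 2 e0).
near=> t; rewrite sub0r normrN.
have tt : t0 <= t by near: t; apply: nbhs_pinfty_ge; rewrite num_real.
have : x i t * x i t <= V t.
  by rewrite /V (bigD1 i) //= lerDl sumr_ge0 // => j _; rewrite -expr2 sqr_ge0.
have := Vdecr _ _ t00 tt => H1 H2.
rewrite -ler_sqr ?nnegrE ?(ltW e0) // real_normK ?num_real // [leLHS]expr2; lra.
Unshelve. all: by end_near.
Qed.

Unset Implicit Arguments.

Theorem theorem2 (R : realType) (N : nat) (A B : 'M[R]_N)
    (beta1 delta1 beta2 delta2 : R) (x y : 'I_N -> R -> R) :
  (1 <= N)%N ->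
  undirected_adjacency A -> graph_connected A ->
  undirected_adjacency B -> graph_connected B ->
  0 < beta1 -> 0 < delta1 -> 0 < beta2 -> 0 < delta2 ->
  scaled_lambda_le (beta1 / delta1) A 1 ->
  scaled_lambda_le (beta2 / delta2) B 1 ->
  bivirus_solution beta1 delta1 beta2 delta2 A B x y ->
  in_D (fun i => x i 0) (fun i => y i 0) ->
  forall i : 'I_N,
    (x i t @[t --> +oo] --> 0) /\ (y i t @[t --> +oo] --> 0).
Proof.
move=> _ adjA _ adjB _ b1 d1 b2 d2 lamA lamB sol D0.
have xyD := bivirus_in_D (adjacency_itv adjA) (adjacency_itv adjB)
  (ltW b1) (ltW d1) (ltW b2) (ltW d2) sol D0.
have yxD t : 0 <= t -> in_D (fun i => y i t) (fun i => x i t).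
  by move=> /xyD H i; have := H i => /=; rewrite [y i t + _]addrC; tauto.
move=> i; split.
- apply: (dominated_virus_cvg0 adjA b1 d1 lamA _ _ xyD) => j.
    by have [] := sol j.
  by move=> t t0; have [_ [_ /(_ t t0)[]]] := sol j.
- apply: (dominated_virus_cvg0 adjB b2 d2 lamB _ _ yxD) => j.
    by have [_ []] := sol j.
  by move=> t t0; have [_ [_ /(_ t t0)[]]] := sol j.
Qed.
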